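(* Let $u\in\mathcal{M}_d$, $u\neq x_1^d$, with $x_1\mid u$, and let $I=(L^f(u))$ be the final lexsegment ideal defined by $u$. Then $$\operatorname{Ass}(S/I)=\{(x_1,\ldots,x_n),(x_2,\ldots,x_n)\}.$$
   Context: $K$ is a field, $S=K[x_1,\ldots,x_n]$, and monomials of $S$ are ordered by the lexicographical order $\geq_{lex}$ induced by $x_1>x_2>\cdots>x_n$. Let $d\geq 2$ be an integer and $\mathcal{M}_d$ the set of monomials of degree $d$ of $S$. For $u,v\in\mathcal{M}_d$ with $u\geq_{lex}v$, $L(u,v)=\{w\in\mathcal{M}_d : u\geq_{lex}w\geq_{lex}v\}$ is a lexsegment set. The final lexsegment ideal determined by $u\in\mathcal{M}_d$ is $(L^f(u))=(L(u,x_n^d))$, the ideal generated by $L(u,x_n^d)$. *)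

(* Defs.v *)
From HB Require Import structures.
From mathcomp Require Import all_boot all_order all_algebra.
From mathcomp Require Import boolp classical_sets.
From mathcomp Require Import mpoly.

Set Implicit Arguments.
Unset Strict Implicit.
Unset Printing Implicit Defensive.

Import Order.TTheory GRing.Theory.

Local Open Scope classical_set_scope.
Local Open Scope ring_scope.
Local Open Scope quotient_scope.

(* The structures [idealr] and [prime_idealr] of [ring_quotient] only cover
   proper ideals given by boolean predicates, hence the versions below. *)
Section Ideals.
Variable R : comNzRingType.

Definition is_ideal (J : set R) : Prop :=
  [/\ J 0, forall x y, J x -> J y -> J (x + y)
    & forall a x, J x -> J (a * x)].

Record ideal := Ideal { ideal_set :> set R; idealP : is_ideal ideal_set }.

Lemma ideal_span_subproof (G : set R) : is_ideal (smallest is_ideal G).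
Proof.
split=> [J | x y Ix Iy J JG | a x Ix J JG].
- case=> -[J0 _ _] _; exact: J0.
- by have [[_ JD _] _] := JG; apply: JD; [apply: Ix | apply: Iy].
- by have [[_ _ JM] _] := JG; apply: JM; apply: Ix.
Qed.

Definition ideal_span (G : set R) : ideal := Ideal (ideal_span_subproof G).

Definition prime_ideal (P : set R) : Prop :=
  [/\ is_ideal P, ~ P 1 & forall x y, P (x * y) -> P x \/ P y].

End Ideals.

Section QuotientModule.
Variables (R : comNzRingType) (I : ideal R).

Definition ideal_pred : {pred R} := fun x => `[< ideal_set I x >].

Lemma ideal_pred_zmod_closed : zmod_closed ideal_pred.
Proof.
have [I0 ID IM] := idealP I.
split=> [|x y /asboolP Ix /asboolP Iy]; first exact/asboolP.
by apply/asboolP; apply: ID; rewrite // -mulN1r; apply: IM.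
Qed.

HB.instance Definition _ :=
  GRing.isZmodClosed.Build R ideal_pred ideal_pred_zmod_closed.

Definition quotient_module : Type := Quotient.quot ideal_pred.

HB.instance Definition _ := GRing.Zmodule.on quotient_module.
HB.instance Definition _ :=
  ZmodQuotient.on quotient_module.

Definition quotient_scale (a : R) (q : quotient_module) : quotient_module :=
  \pi_(quotient_module) (a * repr q).

Lemma quotient_scale_pi a x :
  quotient_scale a (\pi_(quotient_module) x) = \pi_(quotient_module) (a * x).
Proof.
have [_ _ IM] := idealP I.
have : repr (\pi_(quotient_module) x) - x \in ideal_pred.
  by rewrite Quotient.idealrBE; apply/eqP; exact: reprK.
move=> /asboolP Ix; apply/eqP; rewrite -Quotient.idealrBE -mulrBr.
apply/asboolP; apply: IM; exact: Ix.
Qed.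

Lemma quotient_scaleA a b q :
  quotient_scale a (quotient_scale b q) = quotient_scale (a * b) q.
Proof.
by rewrite -[q]reprK (quotient_scale_pi b) !quotient_scale_pi mulrA.
Qed.

Lemma quotient_scale1 : left_id 1 quotient_scale.
Proof. by move=> q; rewrite -[q]reprK quotient_scale_pi mul1r. Qed.

Lemma quotient_scaleDr : right_distributive quotient_scale +%R.
Proof.
move=> a p q; rewrite -[p]reprK -[q]reprK -raddfD !quotient_scale_pi.
by rewrite -raddfD mulrDr.
Qed.

Lemma quotient_scaleDl q : {morph quotient_scale^~ q : a b / a + b}.
Proof.
by move=> a b; rewrite -[q]reprK !quotient_scale_pi mulrDl raddfD.
Qed.

HB.instance Definition _ := GRing.Zmodule_isLmodule.Build R quotient_module
  quotient_scaleA quotient_scale1 quotient_scaleDr quotient_scaleDl.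

End QuotientModule.

Section AssociatedPrimes.
Variables (R : comNzRingType) (M : lmodType R).

Definition annihilator (m : M) : set R := [set a | a *: m = 0].

Definition Ass : set (set R) :=
  [set P | prime_ideal P /\ exists m : M, P = annihilator m].

End AssociatedPrimes.

(* A monomial is identified with its exponent vector; the variable x_i of the
   informal notation is ['X_j] with [j : 'I_n] of value [i - 1]. *)
Section LexSegments.
Variable n : nat.

(* The canonical order of ['X_{1..n}] compares total degrees first; the pure
   lexicographic order with x_1 > x_2 > ... is the one on exponent tuples. *)
Definition mlex_ge (u v : 'X_{1..n}) : bool :=
  ((multinom_val v : n.-tuplelexi nat) <= (multinom_val u : n.-tuplelexi nat))%O.

Definition lexsegment (d : nat) (u v : 'X_{1..n}) : set 'X_{1..n} :=
  [set w | [/\ mdeg w = d, mlex_ge u w & mlex_ge w v]].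

End LexSegments.

Section FinalLexsegmentIdeal.
Variables (K : fieldType) (n : nat).

Definition monomial_ideal (A : set 'X_{1..n}) : ideal {mpoly K[n]} :=
  ideal_span [set 'X_[w] | w in A].

Definition variable_ideal (A : set 'I_n) : ideal {mpoly K[n]} :=
  ideal_span [set 'X_i | i in A].

End FinalLexsegmentIdeal.

Definition final_lexsegment_ideal (K : fieldType) (n d : nat)
    (u : 'X_{1..n.+1}) : ideal {mpoly K[n.+1]} :=
  monomial_ideal K (lexsegment d u (U_(ord_max) *+ d)%MM).

(* Main.v *)
Require Import Defs.
From HB Require Import structures.
From mathcomp Require Import all_boot all_order all_algebra.
From mathcomp Require Import boolp classical_sets.
From mathcomp Require Import mpoly.
From mathcomp Require Import zify.

Set Implicit Arguments.
Unset Strict Implicit.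
Unset Printing Implicit Defensive.

Import Order.TTheory GRing.Theory.

(** Let [a] be the exponent of x_1 in [u], so that 0 < a < d: the bound on the
right holds because [u] is not x_1^d. Let [I] be the final lexsegment ideal.
Two features of the lexicographic order matter. Every monomial of degree [d]
whose x_1-exponent is below [a] is a generator of [I], and no generator has
x_1-exponent above [a].

The annihilator of the class of f in S/I is the colon ideal (I : f), so the
associated primes are the primes of the form P = (I : f) ([AssP]).

Upper bound. For i > 1 the power x_i^d has x_1-exponent 0 < a, so it lies in
[I], hence in P, and P contains (x_2, ..., x_n). On the other hand, as [I] is
generated by monomials and f is not in [I], no member of (I : f) has a nonzero
constant term ([colon_constant_coeff]). A prime squeezed in this way is one of
the two candidates ([prime_above_tail]): modulo (x_2, ..., x_n) only a
univariate polynomial in x_1 is left, and if x_1 is not in P, then powers of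
x_1 can be divided out until the constant term is nonzero.

Existence. If [I] is generated by monomials and [g] is a monomial, then (I : g)
is generated by the variables x_i with i in V as soon as it contains them and
contains no monomial in the other variables ([colon_monomial]). For the maximal
ideal take g = x_1^(a-1) x_n^(d-a): it has degree d - 1, and x_1 g is the least
monomial of degree [d] with x_1-exponent [a]. For (x_2, ..., x_n) there are two
cases ([tail_witness]). If some monomial of degree [d] with x_1-exponent [a] is
not in the segment, it serves as [g]; otherwise x_1^a x_n^(d-a-1) does. *)

Local Open Scope classical_set_scope.
Local Open Scope ring_scope.

(** * Ideals and annihilators *)

Section IdealTheory.
Variables (R : comNzRingType) (J : set R).
Hypothesis idJ : is_ideal J.

Lemma is_ideal0 : J 0. Proof. by case: idJ. Qed.

Lemma is_idealD x y : J x -> J y -> J (x + y).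
Proof. by case: idJ => _ + _; apply. Qed.

Lemma is_idealM a x : J x -> J (a * x).
Proof. by case: idJ => _ _; apply. Qed.

Lemma is_idealB x y : J x -> J y -> J (x - y).
Proof. by move=> Jx Jy; rewrite -mulN1r; apply/is_idealD/is_idealM. Qed.

Lemma is_ideal_sum (I : eqType) (r : seq I) (F : I -> R) :
  {in r, forall i, J (F i)} -> J (\sum_(i <- r) F i).
Proof.
move=> JF; rewrite big_seq; apply: big_ind => //; first exact: is_ideal0.
exact: is_idealD.
Qed.

Lemma is_ideal_colon f : is_ideal [set a | J (a * f)].
Proof.
split=> [|x y|a x] /=; rewrite ?mul0r ?mulrDl -?mulrA.
- exact: is_ideal0.
- exact: is_idealD.
- exact: is_idealM.
Qed.

End IdealTheory.

Lemma prime_idealX (R : comNzRingType) (P : set R) x k :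
  prime_ideal P -> P (x ^+ k) -> P x.
Proof.
case=> _ P1 PM; elim: k => [|k IHk]; first by rewrite expr0.
by rewrite exprS => /PM[].
Qed.

Lemma ideal_span_gen (R : comNzRingType) (G : set R) x :
  G x -> ideal_set (ideal_span G) x.
Proof. by move=> Gx J [_]; apply. Qed.

Lemma ideal_span_min (R : comNzRingType) (G J : set R) :
  is_ideal J -> G `<=` J -> ideal_set (ideal_span G) `<=` J.
Proof. by move=> idJ GJ x; apply. Qed.

Section Annihilators.
Variables (R : comNzRingType) (I : ideal R).

Lemma annihilator_pi (f : R) :
  annihilator (\pi_(quotient_module I)%qT f) = [set a | ideal_set I (a * f)].
Proof.
apply/funext => a; apply/propext.
rewrite /annihilator /= [_ *: _]quotient_scale_pi.
have -> : (0 : quotient_module I) = \pi_(quotient_module I)%qT 0.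
  by rewrite raddf0.
split=> [/eqP|]; last move=> Iaf; rewrite -?Quotient.idealrBE ?subr0.
  by move/asboolP.
by apply/eqP; rewrite -Quotient.idealrBE subr0; apply/asboolP.
Qed.

Lemma AssP (P : set R) :
  Ass (quotient_module I) P <->
  prime_ideal P /\ exists f, P = [set a | ideal_set I (a * f)].
Proof.
split=> -[primeP [f defP]]; split=> //.
  by exists (repr f); rewrite -annihilator_pi reprK.
by exists (\pi_(quotient_module I)%qT f); rewrite annihilator_pi.
Qed.

End Annihilators.

(** * Monomial ideals *)

Section MonomialIdeals.
Variables (K : fieldType) (n : nat).
Implicit Types (A : set 'X_{1..n}) (V : set 'I_n) (p f : {mpoly K[n]}).

Definition multiple_of A (m : 'X_{1..n}) : Prop := exists2 w, A w & (w <= m)%MM.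

Lemma multiple_of_le A m m' :
  multiple_of A m -> (m <= m')%MM -> multiple_of A m'.
Proof.
by case=> w Aw le_wm le_mm'; exists w => //; apply: lepm_trans le_mm'.
Qed.

Lemma monomial_idealP A p :
  ideal_set (monomial_ideal K A) p <->
  {in msupp p, forall m, multiple_of A m}.
Proof.
split=> [|mulA]; last first.
  rewrite [p]mpolyE; apply: (is_ideal_sum (idealP _)) => m /mulA[w Aw le_wm].
  rewrite -mul_mpolyC -(submK le_wm) mpolyXD mulrA.
  by apply: (is_idealM (idealP _)); apply: ideal_span_gen; exists w.
move: p; apply: ideal_span_min => [|_ [w Aw <-] m]; last first.
  by rewrite msuppX inE => /eqP->; exists w => //; apply: lepm_refl.
split=> [m|p q mulp mulq m|a p mulp m]; first by rewrite msupp0.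
  by move/msuppD_le; rewrite mem_cat => /orP[/mulp|/mulq].
move/msuppM_le/allpairsP=> [[m1 m2] /= [_ /mulp mul_m2 ->]].
by apply: multiple_of_le mul_m2 _; apply: lem_addl.
Qed.

Lemma monomial_idealXP A m :
  ideal_set (monomial_ideal K A) 'X_[m] <-> multiple_of A m.
Proof.
split=> [/monomial_idealP|mulA]; first by apply; rewrite msuppX inE.
by apply/monomial_idealP => m'; rewrite msuppX inE => /eqP->.
Qed.

Lemma variable_idealE V :
  variable_ideal K V = monomial_ideal K [set U_(i)%MM | i in V].
Proof.
by rewrite /variable_ideal /monomial_ideal image_comp.
Qed.

Lemma variable_idealP V p :
  ideal_set (variable_ideal K V) p <->
  {in msupp p, forall m : 'X_{1..n}, exists2 i, V i & m i != 0%N}.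
Proof.
rewrite variable_idealE; split=> [/monomial_idealP|] mulV.
  by move=> m /mulV[_ [i Vi <-]]; rewrite lep1mP; exists i.
apply/monomial_idealP => m /mulV[i Vi mi].
by exists U_(i)%MM; [exists i | rewrite lep1mP].
Qed.

(** If p has a nonzero constant term, multiplication by p leaves a monomial of f
visible in the product, unless a proper divisor of it also occurs in f. By
induction on the degree that divisor lies in the ideal, hence so does the
monomial: every monomial of f lies in the ideal. *)
Lemma colon_constant_coeff A p f :
  ideal_set (monomial_ideal K A) (p * f) ->
  ~ ideal_set (monomial_ideal K A) f -> p@_0%MM = 0.
Proof.
move=> /monomial_idealP Apf notAf; apply: contrapT => /eqP p0.
apply: notAf; apply/monomial_idealP => m.
have [N] := ubnP (mdeg m); elim: N m => // N IHN m ltmN fm.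
apply: contrapT => notAm; case: (notAm); apply: Apf.
rewrite mcoeff_msupp; suff -> : (p * f)@_m = p@_0%MM * f@_m.
  by rewrite mulf_neq0 // -mcoeff_msupp.
(* All terms of the convolution but the one of the constant of p vanish. *)
pose r := p - (p@_0%MM)%:MP.
have r0 : r@_0%MM = 0 by rewrite mcoeffB mcoeffC eqxx mulr1 subrr.
rewrite -[p in LHS](subrK (p@_0%MM)%:MP) -/r mulrDl mcoeffD mcoeffCM.
rewrite [X in X + _]mcoeffM big1 ?add0r // => -[[k1 /= _] [k2 /= _]] /eqP def_m.
have [->|k1_neq0] := eqVneq k1 0%MM; first by rewrite r0 mul0r.
have [fk2|/memN_msupp_eq0->] := boolP (k2 \in msupp f); last by rewrite mulr0.
case: notAm; apply: (@multiple_of_le _ k2); last by rewrite def_m lem_addl.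
apply: IHN => //; move: ltmN; rewrite def_m mdegD.
by move: k1_neq0; rewrite -mdeg_eq0 /=; lia.
Qed.

(** Colons of monomial ideals by monomials are again monomial, so only
monomials have to be tested. *)
Lemma colon_monomial A V g :
    (forall i, V i -> multiple_of A (U_(i) + g)%MM) ->
    (forall m : 'X_{1..n}, (forall i, V i -> m i = 0%N) ->
       ~ multiple_of A (m + g)%MM) ->
  [set a | ideal_set (monomial_ideal K A) (a * 'X_[g])] =
  ideal_set (variable_ideal K V).
Proof.
move=> mulV notmul; apply/seteqP; split; last first.
  apply: ideal_span_min => [|_ [i /mulV Vi <-]].
    exact/is_ideal_colon/idealP.
  by rewrite /mkset -mpolyXD; apply/monomial_idealXP.
move=> p /monomial_idealP mulpg; apply/variable_idealP => m pm.
apply: contrapT => noV; apply: (notmul m) => [i Vi|].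
  by apply: contrapT => /eqP mi; apply: noV; exists i.
by apply: mulpg; rewrite mcoeff_msupp addmC mcoeffMX -mcoeff_msupp.
Qed.

(** Substituting 0 for the variables of [V] is an endomorphism whose kernel is
the ideal that they generate; the domain {mpoly K[n]} receives the quotient, so
this ideal is prime. *)
Definition kill_variables V : n.-tuple {mpoly K[n]} :=
  [tuple if `[< V i >] then 0 else 'X_i | i < n].

Lemma kill_variables_sub V p :
  ideal_set (variable_ideal K V) (p - (p \mPo kill_variables V)).
Proof.
have idV := idealP (variable_ideal K V).
pose good p := ideal_set (variable_ideal K V) (p - (p \mPo kill_variables V)).
have goodM q r : good q -> good r -> good (q * r).
  rewrite /good rmorphM /= => Vq Vr.
  set q' := q \mPo _ in Vq *; set r' := r \mPo _ in Vr *.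
  have -> : q * r - q' * r' = q * (r - r') + r' * (q - q').
    by rewrite !mulrBr addrA [r' * q]mulrC subrK [r' * q']mulrC.
  by apply: (is_idealD idV); apply: (is_idealM idV).
have good1 : good 1.
  by rewrite /good comp_mpoly1 subrr; apply: (is_ideal0 idV).
rewrite -/(good p); elim/mpolyind: p => [|c m p _ _ Vp].
  by rewrite /good comp_mpoly0 subrr; apply: (is_ideal0 (idealP _)).
rewrite /good rmorphD /= opprD addrACA; apply: (is_idealD idV) => //.
rewrite -/(good _) -mul_mpolyC; apply: (goodM _ _).
  by rewrite /good comp_mpolyC subrr; apply: (is_ideal0 (idealP _)).
rewrite mpolyXE_id; apply: (big_ind good good1 goodM) => i _.
elim: (m i) => [|k IHk]; rewrite ?expr0 // exprS; apply: (goodM _ _) => //.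
rewrite /good comp_mpolyXU -tnth_nth tnth_mktuple.
case: asboolP => Vi; last by rewrite subrr; apply: (is_ideal0 (idealP _)).
by rewrite subr0; apply: ideal_span_gen; exists i.
Qed.

Lemma kill_variables_eq0 V p :
  ideal_set (variable_ideal K V) p <-> p \mPo kill_variables V = 0.
Proof.
split=> [|p0]; last by rewrite -[p]subr0 -p0; apply: kill_variables_sub.
move: p; apply: ideal_span_min => [|_ [i Vi <-]]; last first.
  by rewrite comp_mpolyXU -tnth_nth tnth_mktuple asboolT.
split=> [|x y x0 y0|a x x0]; first exact: comp_mpoly0.
  by rewrite rmorphD /= x0 y0 addr0.
by rewrite rmorphM /= x0 mulr0.
Qed.

Lemma variable_ideal_prime V : prime_ideal (ideal_set (variable_ideal K V)).
Proof.
split; first exact: idealP.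
  by move/kill_variables_eq0/eqP; rewrite comp_mpoly1 oner_eq0.
move=> x y /kill_variables_eq0/eqP; rewrite rmorphM mulf_eq0.
by case/orP=> /eqP/kill_variables_eq0; [left | right].
Qed.

End MonomialIdeals.

(** * Primes between the tail of the variables and the maximal ideal *)

Section PrimesAboveTail.
Variables (K : fieldType) (n : nat).
Implicit Types (p : {mpoly K[n.+1]}) (P : set {mpoly K[n.+1]}).

Let tail : set 'I_n.+1 := [set i | i <> ord0].

Lemma split_first_variable p :
  exists p0 q, ideal_set (variable_ideal K tail) q /\
    p = (p@_0%MM)%:MP + p0 * 'X_ord0 + q.
Proof.
have idT := idealP (variable_ideal K tail).
elim/mpolyind: p => [|c m p _ _ [p0 [q [Tq defp]]]].
  exists 0, 0; split; first exact: is_ideal0.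
  by rewrite mcoeff0 mul0r !addr0.
have [m0|] := eqVneq m 0%MM.
  exists p0, q; split=> //; rewrite {1}defp m0 mcoeffD mcoeffZ mcoeffX eqxx.
  by rewrite mulr1 mpolyX0 alg_mpolyC mpolyCD !addrA.
move=> m_neq0; rewrite mcoeffD mcoeffZ mcoeffX (negPf m_neq0) mulr0 add0r.
have [m0|] := eqVneq (m ord0) 0%N; last first.
  rewrite -lep1mP => /submK <-.
  exists (c *: 'X_[m - U_(ord0)] + p0), q; split=> //.
  by rewrite {1}defp mpolyXD scalerAl mulrDl !addrA [X in _ = X + _ + _]addrC.
exists p0, (c *: 'X_[m] + q); split.
  apply: (is_idealD idT) => //; apply/variable_idealP => m' /msuppZ_le.
  rewrite msuppX inE => /eqP->; apply: contrapT => notail.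
  case/eqP: m_neq0; apply/mnmP => i; rewrite mnm0E.
  have [->//|/eqP i0] := eqVneq i ord0.
  by apply: contrapT => /eqP mi; apply: notail; exists i.
by rewrite {1}defp addrCA.
Qed.

(** If x_1 is not in P, all coefficients of pure powers of x_1 in members of P
vanish: the constant ones do by hypothesis, and the quotient by x_1 of the
remaining part that depends on x_1 stays in P because P is prime. *)
Lemma prime_above_tail P :
    prime_ideal P -> ideal_set (variable_ideal K tail) `<=` P ->
    (forall p, P p -> p@_0%MM = 0) ->
  P = ideal_set (variable_ideal K [set: 'I_n.+1]) \/
  P = ideal_set (variable_ideal K tail).
Proof.
move=> primeP tailP P0; have [idP _ PM] := primeP.
have [Px0|notPx0] := pselect (P 'X_ord0); [left | right].
  apply/seteqP; split=> [p /P0 p0|]; last first.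
    apply: ideal_span_min => [//|_ [i _ <-]].
    have [->//|/eqP i0] := eqVneq i ord0.
    by apply: tailP; apply: ideal_span_gen; exists i.
  apply/variable_idealP => m; rewrite mcoeff_msupp => pm.
  apply: contrapT => allm0; case/eqP: pm; rewrite -p0; congr _@_ _.
  apply/mnmP => i; rewrite mnm0E; apply: contrapT => /eqP mi.
  by apply: allm0; exists i.
apply/seteqP; split=> // p Pp.
have pure0 k : forall q, P q -> q@_(U_(ord0) *+ k)%MM = 0.
  elim: k => [|k IHk] q Pq; first by rewrite mulm0n P0.
  have [q0 [r [Tr defq]]] := split_first_variable q.
  have Pq0 : P q0.
    rewrite P0 // mpolyC0 add0r in defq.
    case: (PM q0 'X_ord0) => //.
    by rewrite -[_ * _](addrK r) -defq; apply: is_idealB => //; apply: tailP.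
  rewrite defq P0 // mpolyC0 add0r mcoeffD mulmS mcoeffMX IHk // add0r.
  apply/eqP; rewrite mcoeff_eq0; apply/negP.
  move/((variable_idealP _ _).1 Tr) => [i Ti] /eqP; apply.
  have i0 : (ord0 == i) = false by apply/eqP => i0; apply: Ti.
  by rewrite mnmDE mulmnE mnm1E i0.
apply/variable_idealP => m; rewrite mcoeff_msupp => /eqP pm.
apply: contrapT => notail; apply: pm.
rewrite -(pure0 (m ord0) p Pp); congr _@_ _; apply/mnmP => i.
rewrite mulmnE mnm1E; have [<-|i0] := eqVneq ord0 i; first by rewrite mul1n.
rewrite mul0n; apply: contrapT => /eqP mi; apply: notail; exists i => //.
by move=> eqi; rewrite eqi eqxx in i0.
Qed.

End PrimesAboveTail.


(** * Degrees and the lexicographic order *)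

Section Degrees.
Variable n : nat.
Implicit Types m w : 'X_{1..n}.

Lemma mdeg_le w m : (w <= m)%MM -> (mdeg w <= mdeg m)%N.
Proof. by move=> /submK <-; rewrite mdegD leq_addl. Qed.

Lemma mnm_le_mdeg_eq w m : (w <= m)%MM -> mdeg w = mdeg m -> w = m.
Proof.
move=> le_wm eq_deg; rewrite -[RHS](submK le_wm).
suff /eqP-> : (m - w)%MM == 0%MM by rewrite add0m.
by rewrite -mdeg_eq0 -(eqn_add2r (mdeg w)) -mdegD submK // eq_deg.
Qed.

End Degrees.

Section LexOrder.
Variable n : nat.
Implicit Types u v w : 'X_{1..n.+1}.

Lemma mlex_geN u v :
  ~~ mlex_ge u v ->
  exists2 k : 'I_n.+1, (u k < v k)%N &
    forall i : 'I_n.+1, (i < k)%N -> u i = v i.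
Proof.
rewrite /mlex_ge -ltNge => /ltxi_tupleP[k lek].
exists k; first by have := lt_leif (lek k (leqnn _)); rewrite eqxx -!mnm_tnth.
move=> i ltik; have := lek i (ltnW ltik); rewrite neq_ltn ltik /=.
by case=> _ /eqP; rewrite -!mnm_tnth.
Qed.

Lemma mlex_ge_ord0 u v : (v ord0 < u ord0)%N -> mlex_ge u v.
Proof.
move=> lt0; apply: contraT => /mlex_geN[k ltk eqk].
have [k0|k_neq0] := eqVneq k ord0; first by move: ltk; rewrite k0; lia.
by move: lt0; rewrite eqk ?ltnn // lt0n.
Qed.

Lemma ord0_mlex_ge u v : mlex_ge u v -> (v ord0 <= u ord0)%N.
Proof.
move=> ge_uv; rewrite leqNgt; apply/negP => lt0.
have : u = v; last by move=> eq_uv; rewrite eq_uv ltnn in lt0.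
apply/val_inj; apply: (@le_anti _ (n.+1.-tuplelexi nat)); apply/andP; split.
  exact: mlex_ge_ord0.
exact: ge_uv.
Qed.

(** Covers x_n^d and x_1^a x_n^(d-a), the least monomials of degree d without
and with prescribed x_1-exponent a. If v were larger, the first difference
could only be at the last variable, but then the degrees would differ. *)
Lemma mlex_ge_ord_max u v :
    mdeg u = mdeg v -> (forall i, i != ord_max -> v i <= u i)%N ->
  mlex_ge u v.
Proof.
move=> eq_deg le_vu; apply: contraT => /mlex_geN[k ltk eqk].
have k_max : k = ord_max.
  by apply: contraTeq ltk => /le_vu; rewrite -leqNgt.
move: eq_deg; rewrite !mdegE (bigD1 k) //= [in RHS](bigD1 k) //=.
rewrite (eq_bigr (fun i => v i)) => [/addIn eq_k|i neq_ik].
  by rewrite eq_k ltnn in ltk.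
apply: eqk; rewrite k_max in neq_ik *.
by rewrite ltn_neqAle neq_ik -ltnS ltn_ord.
Qed.

End LexOrder.

(** * The final lexsegment and the witnesses *)

Section FinalSegment.
Variables (n d : nat) (u : 'X_{1..n.+1}).
Hypotheses (deg_u : mdeg u = d) (u0_gt0 : (0 < u ord0)%N).
Hypothesis u0_ltd : (u ord0 < d)%N.
Implicit Types w m : 'X_{1..n.+1}.

Let L : set 'X_{1..n.+1} := lexsegment d u (U_(ord_max) *+ d)%MM.

(** The lower bound x_n^d of the segment is the least monomial of degree d. *)
Lemma final_segmentP w : L w <-> mdeg w = d /\ mlex_ge u w.
Proof.
split=> [[]|[deg_w ge_uw]] //; split=> //; apply: mlex_ge_ord_max.
  by rewrite mdegMn mdeg1 mul1n.
by move=> i /negPf i_max; rewrite mulmnE mnm1E eq_sym i_max.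
Qed.

Lemma final_segment_lt0 w : mdeg w = d -> (w ord0 < u ord0)%N -> L w.
Proof. by move=> deg_w /mlex_ge_ord0 ge_uw; apply/final_segmentP. Qed.

(** With a single variable, u would be the excluded power of x_1. *)
Lemma ord_max_neq0 : ord_max != ord0 :> 'I_n.+1.
Proof.
apply: contraTneq u0_ltd => max0; rewrite -leqNgt -deg_u mdegE (bigD1 ord0) //=.
rewrite big1 ?addn0 // => i; case/eqP; apply/val_inj => /=.
by have := ltn_ord i; move/(congr1 val): max0 => /=; lia.
Qed.

(** The monomial x_1^(a-1) x_n^(d-a) of degree d - 1 is sent into the segment
by x_1 because the product is the least one with x_1-exponent a, and by every
other variable because the x_1-exponent stays below a. *)
Lemma socle_witness (i : 'I_n.+1) :
  L (U_(i) + (U_(ord0) *+ (u ord0).-1 + U_(ord_max) *+ (d - u ord0)))%MM.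
Proof.
have max0 := negPf ord_max_neq0.
have deg_w : mdeg (U_(i) + (U_(ord0) *+ (u ord0).-1 +
                   U_(ord_max) *+ (d - u ord0)))%MM = d.
  by rewrite !mdegD !mdegMn !mdeg1; lia.
have [i0|i_neq0] := eqVneq i ord0; last first.
  apply: final_segment_lt0 => //.
  by rewrite !mnmDE !mulmnE !mnm1E eqxx max0 (negPf i_neq0); lia.
apply/final_segmentP; split=> //.
apply: mlex_ge_ord_max; first by rewrite deg_w.
move=> j /negPf j_max.
rewrite !mnmDE !mulmnE !mnm1E i0 [ord_max == j]eq_sym j_max.
by case: eqVneq => [<-|_]; lia.
Qed.

(** The conditions on [g] are stable under multiplying [g] by powers of x_1, as
the segment has no monomial with x_1-exponent above that of [u] and [g]. *)
Lemma tail_witness :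
  exists g : 'X_{1..n.+1}, [/\ g ord0 = u ord0, (forall w, L w -> ~ (w <= g)%MM)
    & forall i, i <> ord0 -> multiple_of L (U_(i) + g)%MM].
Proof.
have max0 := negPf ord_max_neq0.
have [[v [deg_v v0 notge_uv]]|allge] :=
  pselect (exists v, [/\ mdeg v = d, v ord0 = u ord0 & ~ mlex_ge u v]).
(* A product x_i v with i > 1 has degree d + 1 and is divisible by x_1; the
   divisor x_i v / x_1 lies in the segment. *)
- exists v; split=> // [w /final_segmentP[deg_w ge_uw] le_wv|i i_neq0].
    by apply: notge_uv; rewrite -(mnm_le_mdeg_eq le_wv) // deg_w.
  have le0v : (U_(ord0) <= U_(i) + v)%MM by rewrite lep1mP mnmDE v0; lia.
  exists (U_(i) + v - U_(ord0))%MM; last exact: lem_subr.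
  have /eqP/negPf i0 := i_neq0.
  apply: final_segment_lt0; last by rewrite mnmBE mnmDE !mnm1E eqxx i0; lia.
  by have := congr1 mdeg (submK le0v); rewrite !mdegD !mdeg1; lia.
(* All monomials of degree d with x_1-exponent a are in the segment, so that
   degree d - 1 is enough. *)
exists (U_(ord0) *+ u ord0 + U_(ord_max) *+ (d - u ord0).-1)%MM; split.
- by rewrite !mnmDE !mulmnE !mnm1E eqxx max0; lia.
- move=> w /final_segmentP[deg_w _] /mdeg_le.
  by rewrite mdegD !mdegMn !mdeg1 deg_w; lia.
move=> i /eqP/negPf i0; eexists; last exact: lepm_refl.
apply/final_segmentP; rewrite !mdegD !mdegMn !mdeg1; split; first by lia.
apply: contrapT => notge; apply: allge; eexists; split; last exact: notge.
  by rewrite !mdegD !mdegMn !mdeg1; lia.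
by rewrite !mnmDE !mulmnE !mnm1E eqxx max0 i0; lia.
Qed.

End FinalSegment.

(** * Associated primes of final lexsegment ideals *)

Theorem proposition2p3 (K : fieldType) (n d : nat) (u : 'X_{1..n.+1})
    (hd : (2 <= d)%N) (hu : mdeg u = d)
    (hu_neq : u <> (U_(ord0) *+ d)%MM)
    (hu_x1 : (U_(ord0) <= u)%MM) :
  Ass (quotient_module (final_lexsegment_ideal K d u)) =
  [set ideal_set (variable_ideal K [set: 'I_n.+1]);
       ideal_set (variable_ideal K [set i : 'I_n.+1 | i <> ord0])].
Proof.
have u0_gt0 : (0 < u ord0)%N by rewrite lt0n -lep1mP.
have u0_ltd : (u ord0 < d)%N.
  rewrite ltnNge; apply/negP => le_du0; apply: hu_neq; apply/esym.
  apply: mnm_le_mdeg_eq; last by rewrite mdegMn mdeg1 mul1n.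
  apply/mnm_lepP => i; rewrite mulmnE mnm1E.
  by case: eqVneq => [<-|_]; rewrite ?mul1n ?mul0n.
apply/seteqP; split=> P.
  move=> /AssP[primeP [f defP]]; have [_ P1 _] := primeP.
  apply: prime_above_tail => // [|p].
    apply: ideal_span_min => [|_ [i /eqP/negPf i0 <-]]; first by case: primeP.
    (* P contains I, hence x_i^d. *)
    apply: (prime_idealX (k := d)) => //; rewrite defP /mkset mulrC.
    apply: (is_idealM (idealP _)); rewrite mpolyXn; apply/monomial_idealXP.
    exists (U_(i) *+ d)%MM; last exact: lepm_refl.
    apply: final_segment_lt0; first by rewrite mdegMn mdeg1 mul1n.
    by rewrite mulmnE mnm1E i0 mul0n.
  rewrite defP => /colon_constant_coeff; apply.
  by move: P1; rewrite defP /mkset mul1r.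
case=> ->; apply/AssP; (split; first exact: variable_ideal_prime).
  exists 'X_[U_(ord0) *+ (u ord0).-1 + U_(ord_max) *+ (d - u ord0)].
  apply/esym/colon_monomial => [i _|m m0].
    eexists; last exact: lepm_refl.
    exact: socle_witness.
  have -> : m = 0%MM by apply/mnmP => i; rewrite mnm0E m0.
  case=> w /final_segmentP[deg_w _] /mdeg_le.
  by rewrite add0m mdegD !mdegMn !mdeg1 deg_w; lia.
have [g [g0 notLg mulLg]] := tail_witness hu u0_gt0 u0_ltd.
(* A generator dividing x_1^k g has x_1-exponent at most a, so divides g. *)
exists 'X_[g]; apply/esym/colon_monomial => // m m0 [w Lw le_w_mg].
apply: (notLg w Lw); apply/mnm_lepP => i.
have [->|/eqP i0] := eqVneq i ord0.
  by have /final_segmentP[_ /ord0_mlex_ge] := Lw; rewrite g0.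
by have /mnm_lepP/(_ i) := le_w_mg; rewrite mnmDE m0.
Qed.
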